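(* Let $(W,S)$ be an arbitrary Coxeter system (with $W$ possibly infinite), and let $\leq$ denote the Bruhat order on $W$ with respect to $S$. Let $x,y\in W$ with $x\leq y$, let $J\subseteq S$, and let $C$ be a parabolic coset with respect to $J$, i.e. $C=uW_J$ or $C=W_Ju$ for some $u\in W$. If the intersection $[x,y]\cap C$ is nonempty, then it is a Bruhat interval, i.e. there exist $a,b\in W$ with $a\leq b$ such that $$[x,y]\cap C=[a,b].$$
   Context: For a Coxeter system $(W,S)$, the Bruhat order (also called Bruhat-Chevalley order) on $W$ is the standard strong Bruhat order with respect to $S$: the partial order that is the transitive closure of the relations $w< wt$ for $w \in W$ and $t$ a reflection (a conjugate in $W$ of an element of $S$) with $\ell(w)<\ell(wt)$, where $\ell$ is the length function of $(W,S)$. For $x\le y$ in $W$, the Bruhat interval $[x,y]$ is the set $\{w\in W : x\leq w\leq y\}$. For $J\subseteq S$, $W_J$ denotes the parabolic subgroup of $W$ generated by $J$; a parabolic coset is a left coset $uW_J$ or a right coset $W_Ju$ with $u\in W$. *)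

(* Defs.v *)
From mathcomp Require Export all_boot.
From mathcomp Require Export boolp classical_sets.
From Stdlib Require Export Relation_Operators.

Set Implicit Arguments.
Unset Strict Implicit.
Unset Printing Implicit Defensive.

Local Open Scope classical_set_scope.
Local Open Scope group_scope.

Definition generated_subgroup (W : groupType) (A : set W) : set W :=
  smallest [set H : set W | group_closed (mem H)] A.

(* [m s t = None] encodes m(s,t) = oo; only the values of [m] on [S] matter. *)
Definition coxeter_matrix (W : Type) (S : set W) (m : W -> W -> option nat) :
    Prop :=
  [/\ forall s, S s -> m s s = Some 1%N,
      forall s t, S s -> S t -> m s t = m t s &
      forall s t, S s -> S t -> s <> t ->
        forall n, m s t = Some n -> (2 <= n)%N].

Definition coxeter_relations (W : Type) (G : groupType) (S : set W)
    (m : W -> W -> option nat) (f : W -> G) : Prop :=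
  forall s t, S s -> S t -> forall n, m s t = Some n -> (f s * f t) ^+ n = 1.

(* W is the group presented by < S | (s t)^m(s,t) = 1 whenever m(s,t) < oo >:
   S generates W, satisfies the relations, and every map from S to a group G
   satisfying them extends to W (uniquely, as S generates). [S] may be
   infinite. *)
Definition coxeter_system (W : groupType) (S : set W) : Prop :=
  exists m : W -> W -> option nat,
    [/\ coxeter_matrix S m,
        generated_subgroup S = setT,
        coxeter_relations S m (fun w => w) &
        forall (G : groupType) (f : W -> G), coxeter_relations S m f ->
          exists phi : {multiplicative W -> G}, forall s, S s -> phi s = f s].

Section Bruhat.
Variables (W : groupType) (S : set W).

Definition expressible (w : W) (n : nat) : Prop :=
  exists r : seq W,
    [/\ size r = n, {in r, forall s, S s} & \prod_(s <- r) s = w].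

(* The default value 0 is never used when S is a set of involutions
   generating W. *)
Definition length (w : W) : nat :=
  xget 0%N [set n | expressible w n /\
                    forall k, expressible w k -> (n <= k)%N].

Definition reflection (t : W) : Prop := exists s w : W, S s /\ t = s ^ w.

Definition bruhat_step (v w : W) : Prop :=
  exists t, [/\ reflection t, w = v * t & (length v < length w)%N].

Definition bruhat (v w : W) : Prop := clos_refl_trans W bruhat_step v w.

Definition bruhat_interval (x y : W) : set W :=
  [set w | bruhat x w /\ bruhat w y].

End Bruhat.

Definition parabolic_coset (W : groupType) (J C : set W) : Prop :=
  exists u : W,
    C = [set u * w | w in generated_subgroup J] \/
    C = [set w * u | w in generated_subgroup J].

(* Main.v *)
From HB Require Import structures.
Require Import Defs.

Set Implicit Arguments.
Unset Strict Implicit.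
Unset Printing Implicit Defensive.

(** Fix a left coset [C] of [W_J]. The intersection of [C] with the interval
    from [x] to [y] is an interval because of three facts:
    - if some element of [C] is below [y], there is a greatest such element
      [b] ([max_below]);
    - if some element of [C] is above [x], there is a least such element [a]
      ([min_above]);
    - [C] is convex for the Bruhat order ([coset_convex]).
    When the intersection contains [z], the first two facts give
    [x <= a <= z <= b <= y], and convexity puts the whole interval from [a] to
    [b] inside [C] ([coset_interval]). Right cosets reduce to left ones, since
    inversion preserves the Bruhat order ([bruhatV]).

    The existence of [a] cannot be deduced from that of [b] by multiplying by
    a longest element when [W] is infinite, so each is obtained by its own
    induction. Both use a simple reflection [s] acting on the left: the maps
    [up s w = max (w, s w)] and [down s w = min (w, s w)] are monotone
    ([up_le_up], [down_le_down]), and unless [s C = C], either every element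
    of [C] has [s] as a left descent or none has ([coset_descent]).
    For [b] the induction is on the length of [y], with [s] a left descent of
    [y]: everything below [y] is obtained from what is below [s y] by [up s].
    For [a] the induction is on the least length in [C], with [s] a left
    descent of an element [u] of least length; then [s C] differs from [C],
    and [w >= x] is equivalent to [s w >= down s x] for [w] in [C].

    Everything about the order rests on the strong exchange property: there
    is a function [N] such that [N w t] holds, for a reflection [t], exactly
    when [t w] is shorter than [w] ([cocycle_length]). It is produced from the
    presentation of [W] by [inversion_cocycle]. *)

Local Open Scope classical_set_scope.
Local Open Scope group_scope.

(** * The inversion cocycle *)

Section TwistedProduct.
Variable W : groupType.

(** The semidirect product of the group of subsets of [W], under symmetric
    difference, by [W] acting by conjugation. A homomorphic section of its
    projection to [W] is the same thing as a cocycle [W -> W -> bool]. *)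
Definition twisted : Type := ((W -> bool) * W)%type.

HB.instance Definition _ := Choice.on twisted.

Definition twisted_mul (a b : twisted) : twisted :=
  (fun t => a.1 t (+) b.1 (t ^ a.2), a.2 * b.2).
Definition twisted_one : twisted := (fun=> false, 1).
Definition twisted_inv (a : twisted) : twisted :=
  (fun t => a.1 (t ^ a.2^-1), a.2^-1).

Lemma twisted_mulA : associative twisted_mul.
Proof.
move=> [f u] [g v] [h w]; rewrite /twisted_mul /= mulgA; congr pair.
by apply/funext => t; rewrite conjgM addbA.
Qed.

Lemma twisted_mul1g : left_id twisted_one twisted_mul.
Proof.
move=> [f u]; rewrite /twisted_mul /= mul1g; congr pair.
by apply/funext => t; rewrite conjg1.
Qed.

Lemma twisted_mulg1 : right_id twisted_one twisted_mul.
Proof.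
move=> [f u]; rewrite /twisted_mul /= mulg1; congr pair.
by apply/funext => t; rewrite addbF.
Qed.

Lemma twisted_mulVg : left_inverse twisted_one twisted_inv twisted_mul.
Proof.
move=> [f u]; rewrite /twisted_mul /twisted_inv /= mulVg; congr pair.
by apply/funext => t; rewrite addbb.
Qed.

Lemma twisted_mulgV : right_inverse twisted_one twisted_inv twisted_mul.
Proof.
move=> [f u]; rewrite /twisted_mul /twisted_inv /= mulgV; congr pair.
by apply/funext => t; rewrite conjgK addbb.
Qed.

HB.instance Definition _ := isGroup.Build twisted
  twisted_mulA twisted_mul1g twisted_mulg1 twisted_mulVg twisted_mulgV.

(** The generator [s] is lifted together with its only inversion, itself. *)
Definition twisted_gen (s : W) : twisted := (eq_op^~ s, s).

(** The set attached to [(s t) ^+ n] collects the alternating words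
    [s, sts, ststs] and so on; these are the elements [(s t) ^+ j * s] for
    [j < 2n]. *)
Lemma twisted_gen_expg (s t x : W) (n : nat) : s * s = 1 -> t * t = 1 ->
  ((twisted_gen s * twisted_gen t) ^+ n).1 x =
    \big[addb/false]_(0 <= j < n + n) (x == (s * t) ^+ j * s) /\
  ((twisted_gen s * twisted_gen t) ^+ n).2 = (s * t) ^+ n.
Proof.
move=> ss tt; have sV : s^-1 = s by apply: mulg1_eq.
have tV : t^-1 = t by apply: mulg1_eq.
(* [s] inverts [s * t] by conjugation. *)
have sdV k : s * (s * t) ^- k = (s * t) ^+ k * s.
  have -> : (s * t) ^- k = (t * s) ^+ k by rewrite -expVgn invgM sV tV.
  elim: k => [|k IH]; first by rewrite !expg0 mulg1 mul1g.
  by rewrite !expgSr !mulgA IH.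
have conj_eq (u y z : W) : (y ^ u == z) = (y == z ^ u^-1).
  by apply/eqP/eqP => [<-|->]; rewrite ?conjgK ?conjgKV.
elim: n => [|n [IH1 IH2]]; first by rewrite !expg0 big_geq.
rewrite expgSr; split; last by rewrite expgSr -IH2.
rewrite addSn addnS !big_nat_recr //= -IH1 -addbA; congr (_ (+) _).
rewrite IH2 /= !conj_eq !conjgE !invgK sV.
congr (_ (+) _); first by rewrite sdV mulgA -expgnDr.
by rewrite -!mulgA sdV !mulgA -(mulgA _ s t) -expgSr -expgnDr addSn.
Qed.

End TwistedProduct.

(** When [(s t) ^+ n = 1] the list of elements [(s t) ^+ j * s] with [j < 2n]
    runs through the same [n] values twice, so their symmetric difference is
    empty. Hence the lifted generators satisfy the Coxeter relations, the
    universal property extends them to a morphism, and its first component is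
    a cocycle. *)
Lemma inversion_cocycle (W : groupType) (S : set W) : coxeter_system S ->
  exists N : W -> W -> bool,
    (forall s, S s -> N s = eq_op^~ s) /\
    (forall u v t, N (u * v) t = N u t (+) N v (t ^ u)).
Proof.
move=> [m [[mss _ _] Sgen mrel univ]].
have ss s : S s -> s * s = 1.
  by move=> Ss; have := mrel s s Ss Ss 1%N (mss s Ss); rewrite expg1.
have twrel : coxeter_relations S m (@twisted_gen W).
  move=> s t Ss St n mst.
  have [E1 E2] : (forall x, ((twisted_gen s * twisted_gen t) ^+ n).1 x = false)
      /\ ((twisted_gen s * twisted_gen t) ^+ n).2 = 1.
    have st1 : (s * t) ^+ n = 1 := mrel s t Ss St n mst.
    have tE x := twisted_gen_expg x n (ss s Ss) (ss t St).
    split=> [x|]; last by have [_ ->] := tE 1.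
    have [-> _] := tE x; rewrite (@big_cat_nat _ _ _ n) //= ?leq_addr //.
    rewrite -{2}[n]add0n big_addn addnK.
    under [X in _ (+) X]eq_bigr => j _ do rewrite expgnDr st1 mulg1.
    exact: addbb.
  case: (_ ^+ n) E1 E2 => f u /= f0 ->; congr pair.
  exact/funext.
have [phi phiE] := univ _ _ twrel.
have phiM u v : phi (u * v) = phi u * phi v by exact: gmulfM.
have phi2 w : (phi w).2 = w.
  suff : [set w | (phi w).2 = w] w by [].
  have : generated_subgroup S w by rewrite Sgen.
  apply: smallest_sub => [|s Ss /=]; last by rewrite phiE.
  have phi1 : (phi 1).2 = 1.
    have := phiM 1 1; rewrite mulg1 => /(congr1 (fun a : twisted W => a.2)).
    by rewrite /= => /(congr1 (fun a => (phi 1).2^-1 * a)); rewrite mulVg mulKg.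
  split=> [|u v]; rewrite !inE /= ?mem_setE //.
  move=> Eu Ev.
  have : (phi (u / v * v)).2 = (phi (u / v)).2 * v by rewrite phiM /= Ev.
  rewrite mulgVK Eu => /(congr1 (fun a => a / v)); rewrite mulgK; exact: esym.
exists (fun w => (phi w).1); split=> [s Ss|u v t]; first by rewrite phiE.
by rewrite phiM /= phi2.
Qed.

(** * Strong exchange *)

Section Coxeter.
Variables (W : groupType) (S : set W) (N : W -> W -> bool).
Hypotheses (invS : forall s, S s -> s * s = 1)
           (genS : generated_subgroup S = setT)
           (cocycle_gen : forall s, S s -> N s = eq_op^~ s)
           (cocycleM : forall u v t, N (u * v) t = N u t (+) N v (t ^ u)).

Local Notation len := (length S).
Local Notation "x <=B y" := (bruhat S x y) (at level 70, no associativity).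

Lemma gen_invg s : S s -> s^-1 = s.
Proof. by move=> Ss; apply: mulg1_eq; apply: invS. Qed.

Lemma genK s w : S s -> s * (s * w) = w.
Proof. by move=> Ss; rewrite mulgA invS // mul1g. Qed.

Lemma genKr s w : S s -> w * s * s = w.
Proof. by move=> Ss; rewrite -mulgA invS // mulg1. Qed.

Lemma expressible1 : expressible S 1 0.
Proof. by exists [::]; split; rewrite ?big_nil. Qed.

Lemma expressibleM u v m n :
  expressible S u m -> expressible S v n -> expressible S (u * v) (m + n).
Proof.
move=> [p [<- Sp <-]] [q [<- Sq <-]]; exists (p ++ q).
split; rewrite ?size_cat ?big_cat //.
by move=> s; rewrite mem_cat => /orP[/Sp|/Sq].
Qed.

Lemma expressible_gen s : S s -> expressible S s 1.
Proof.
move=> Ss; exists [:: s]; split; rewrite ?big_seq1 //.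
by move=> t; rewrite inE => /eqP ->.
Qed.

Lemma expressibleV w n : expressible S w n -> expressible S w^-1 n.
Proof.
move=> [r [<- Sr <-]]; elim: r Sr => [|s r IH] Sr.
  by rewrite big_nil invg1; apply: expressible1.
rewrite big_cons invgM /= -addn1; apply: expressibleM.
  by apply: IH => t tr; apply: Sr; rewrite inE tr orbT.
have Ss : S s by apply: Sr; rewrite inE eqxx.
by rewrite gen_invg //; apply: expressible_gen.
Qed.

Lemma expressible_ex w : exists n, expressible S w n.
Proof.
suff : [set w | exists n, expressible S w n] w by [].
have : generated_subgroup S w by rewrite genS.
apply: smallest_sub => [|s Ss]; last by exists 1%N; apply: expressible_gen.
split=> [|u v]; rewrite !inE; first by exists 0%N; apply: expressible1.
move=> [m um] [n vn]; exists (m + n)%N; apply: expressibleM => //.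
exact: expressibleV.
Qed.

Lemma lengthP w :
  expressible S w (len w) /\ forall n, expressible S w n -> (len w <= n)%N.
Proof.
rewrite /length; case: xgetP => [n -> //|none]; exfalso.
have [n0 wn0] := expressible_ex w.
have ex : exists n, `[< expressible S w n >] by exists n0; apply/asboolP.
case: (ex_minnP ex) => n /asboolP wn nmin; apply: (none n); split=> // k wk.
by apply: nmin; apply/asboolP.
Qed.

Lemma length_min w n : expressible S w n -> (len w <= n)%N.
Proof. by have [_] := lengthP w; apply. Qed.

Lemma lengthV w : len w^-1 = len w.
Proof.
apply/eqP; rewrite eqn_leq; apply/andP; split.
  by apply: length_min; apply: expressibleV; case: (lengthP w).
rewrite -{1}[w]invgK.
by apply: length_min; apply: expressibleV; case: (lengthP w^-1).
Qed.

Lemma reflection_gen s : S s -> reflection S s.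
Proof. by move=> Ss; exists s, 1; rewrite conjg1. Qed.

Lemma reflectionJ t w : reflection S t -> reflection S (t ^ w).
Proof. by move=> [s [u [Ss ->]]]; exists s, (u * w); rewrite conjgM. Qed.

Lemma reflectionK t w : reflection S t -> t * (t * w) = w.
Proof.
move=> [s [u [Ss ->]]].
by rewrite mulgA -conjMg invS // conj1g mul1g.
Qed.

Lemma cocycle1 t : N 1 t = false.
Proof. by have := cocycleM 1 1 t; rewrite mulg1 conjg1 addbb. Qed.

Lemma cocycleV w t : N w^-1 t = N w (t ^ w^-1).
Proof.
have := cocycleM w w^-1 (t ^ w^-1); rewrite mulgV cocycle1 conjgKV.
by case: (N w _); case: (N _ t).
Qed.

(** Writing [t] as [s] conjugated by [w], the contributions of [w^-1] and of
    [w] at [t] cancel, which leaves that of [s], equal to one. *)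
Lemma cocycle_refl t : reflection S t -> N t t.
Proof.
move=> [s [w [Ss ->]]].
have sws : (s ^ w) ^ w^-1 = s by rewrite conjgK.
have ss : s ^ s = s by rewrite conjgE mulgA mulVg mul1g.
rewrite {1}conjgE !cocycleM cocycleV sws (cocycle_gen Ss) eqxx ss.
by case: (N w s).
Qed.

Lemma cocycle_gen_mul s w t : S s -> N (s * w) t = (t == s) (+) N w (t ^ s).
Proof. by move=> Ss; rewrite cocycleM (cocycle_gen Ss). Qed.

(** [N w] is the symmetric difference of the reflections attached to the
    letters of a word for [w]. If [t] is in it, then [t] is attached to some
    letter, and multiplying by [t] deletes that letter. *)
Lemma cocycle_shorten w n t :
  expressible S w n -> N w t ->
  exists2 k, (k < n)%N & expressible S (t * w) k.
Proof.
move=> [r [<- Sr <-]]; elim: r t Sr => [|s r IH] t Sr.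
  by rewrite big_nil cocycle1.
have Ss : S s by apply: Sr; rewrite inE eqxx.
have Sr' : {in r, forall s, S s} by move=> v vr; apply: Sr; rewrite inE vr orbT.
rewrite big_cons cocycle_gen_mul //; case: eqP => [->|_] /=.
  by move=> _; exists (size r) => //; rewrite genK //; exists r.
move=> /(IH _ Sr') [k kr tk]; exists k.+1 => //.
rewrite mulgA (conjgC t s) -mulgA -[k.+1]add1n.
by apply: expressibleM => //; apply: expressible_gen.
Qed.

(** The strong exchange property. For the converse of the deletion argument,
    multiplication by [t] toggles [N _ t], so that if [N w t] fails then it
    holds for [t * w], which is therefore shortened to [w]. *)
Lemma cocycle_length t w : reflection S t -> N w t = (len (t * w) < len w)%N.
Proof.
have shorten v : N v t -> (len (t * v) < len v)%N.
  have [ev _] := lengthP v => /(cocycle_shorten ev) [k kv /length_min].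
  by move=> /leq_ltn_trans; apply.
move=> rt; apply/idP/idP; first exact: shorten.
apply: contraTT => Nwt; rewrite -leqNgt; apply: ltnW.
have := shorten (t * w); rewrite reflectionK //; apply.
by rewrite cocycleM cocycle_refl // conjgE mulKg (negbTE Nwt).
Qed.

Lemma descent_gen_mul s w : S s -> N (s * w) s = ~~ N w s.
Proof.
by move=> Ss; rewrite cocycle_gen_mul // eqxx conjgE mulKg.
Qed.

Lemma descent_length s w : S s -> N w s -> (len (s * w) < len w)%N.
Proof. by move=> Ss; rewrite cocycle_length //; apply: reflection_gen. Qed.

Lemma descent_exists w : w <> 1 -> exists2 s, S s & N w s.
Proof.
have [[r [rw Sr Er]] _] := lengthP w.
case: r Sr rw Er => [|s r] Sr; first by rewrite big_nil => _ <-.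
have Ss : S s by apply: Sr; rewrite inE eqxx.
rewrite big_cons => rw Ew _; exists s => //.
rewrite cocycle_length -?rw; last exact: reflection_gen.
rewrite -Ew genK // ltnS; apply: length_min; exists r; split=> // v vr.
by apply: Sr; rewrite inE vr orbT.
Qed.

(** * Monotonicity of multiplication by a simple reflection *)

(** Since [v * t] is the product of a conjugate of [t] by [v], the Bruhat
    order may be defined by left multiplications just as well. *)
Lemma bruhat_stepP v w : bruhat_step S v w <->
  exists t, [/\ reflection S t, w = t * v & ~~ N v t].
Proof.
split=> [[t [rt -> vt]]|[t [rt -> vt]]].
  exists (t ^ v^-1).
  have Et : t ^ v^-1 * v = v * t by rewrite conjgE invgK -!mulgA mulVg mulg1.
  have rt' := reflectionJ v^-1 rt.
  by split=> //; rewrite cocycle_length // Et -leqNgt ltnW.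
exists (t ^ v); split; [exact: reflectionJ|exact: conjgC|].
have := cocycle_length (t * v) rt; rewrite reflectionK // => <-.
by rewrite cocycleM cocycle_refl // conjgE mulKg (negbTE vt).
Qed.

Lemma bruhat_refl x : x <=B x. Proof. exact: rt_refl. Qed.

Lemma bruhat_trans y x z : x <=B y -> y <=B z -> x <=B z.
Proof. exact: rt_trans. Qed.

Lemma bruhat_length x y : x <=B y -> x = y \/ (len x < len y)%N.
Proof.
elim=> [v w [t [_ _ vw]]|v|u v w _ IH1 _ IH2]; [by right|by left|].
case: IH1 => [->//|uv]; case: IH2 => [<-|vw]; right=> //.
exact: ltn_trans vw.
Qed.

Lemma bruhat_anti x y : x <=B y -> y <=B x -> x = y.
Proof.
move=> /bruhat_length[//|xy] /bruhat_length[//|yx].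
by have := ltn_trans xy yx; rewrite ltnn.
Qed.

Lemma bruhatV x y : x <=B y -> x^-1 <=B y^-1.
Proof.
elim=> [v w [t [rt -> vw]]|v|u v w _ IH1 _ IH2]; last 2 first.
- exact: bruhat_refl.
- exact: bruhat_trans IH2.
apply: rt_step; apply/bruhat_stepP; exists t; split=> //.
  rewrite invgM; congr (_ * _); apply: mulg1_eq.
  by have := reflectionK 1 rt; rewrite mulg1.
rewrite cocycle_length // -leqNgt lengthV.
have -> : t * v^-1 = (v * t)^-1.
  rewrite invgM; congr (_ * _); apply/esym/mulg1_eq.
  by have := reflectionK 1 rt; rewrite mulg1.
by rewrite lengthV ltnW.
Qed.

Lemma bruhat_ascent s w : S s -> ~~ N w s -> w <=B s * w.
Proof.
move=> Ss ws; apply: rt_step; apply/bruhat_stepP; exists s; split=> //.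
exact: reflection_gen.
Qed.

Lemma bruhat_descent s w : S s -> N w s -> s * w <=B w.
Proof.
move=> Ss ws; rewrite -{2}(genK w Ss); apply: bruhat_ascent => //.
by rewrite descent_gen_mul // ws.
Qed.

(** The elements [w] and [s * w] are always comparable; these are their
    maximum and minimum. *)
Definition up s w := if N w s then w else s * w.
Definition down s w := if N w s then s * w else w.

Lemma le_up s w : S s -> w <=B up s w /\ s * w <=B up s w.
Proof.
move=> Ss; rewrite /up; case: ifPn => ws; split; try exact: bruhat_refl.
  exact: bruhat_descent.
exact: bruhat_ascent.
Qed.

Lemma down_le s w : S s -> down s w <=B w /\ down s w <=B s * w.
Proof.
move=> Ss; rewrite /down; case: ifPn => ws; split; try exact: bruhat_refl.
  exact: bruhat_descent.
exact: bruhat_ascent.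
Qed.

(** For [w = t * v] with [t] different from [s], multiplication by [s] keeps
    the step increasing: [s * w] is [t ^ s] times [s * v], and [t ^ s] is an
    inversion of [s * v] exactly when [t] is one of [v]. *)
Lemma step_mulgen s v w : S s -> bruhat_step S v w ->
  w = s * v \/ s * v <=B s * w.
Proof.
move=> Ss /bruhat_stepP [t [rt -> vt]].
have [->|/eqP ts] := eqVneq t s; first by left.
right; apply: rt_step; apply/bruhat_stepP; exists (t ^ s).
have ss : (t ^ s) ^ s = t by rewrite -conjgM invS // conjg1.
split; first exact: reflectionJ.
  by rewrite conjgE gen_invg // !mulgA genKr // invS // mul1g.
rewrite cocycle_gen_mul // ss (negbTE vt) addbF; apply/eqP => tss.
by apply: ts; rewrite -ss tss conjgE mulKg.
Qed.

(** This and [down_le_down] together are the lifting property of the Bruhat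
    order. *)
Lemma up_le_up x y s : S s -> x <=B y -> up s x <=B up s y.
Proof.
move=> Ss; elim=> [v w vw|v|u v w _ IH1 _ IH2].
- case: (step_mulgen Ss vw) => [->|svw].
    rewrite /up descent_gen_mul // genK //.
    by case: (N v s); apply: bruhat_refl.
  have [wu swu] := le_up w Ss.
  rewrite {1}/up; case: ifP => _;
    [apply: bruhat_trans wu|apply: bruhat_trans swu] => //.
  exact: rt_step.
- exact: bruhat_refl.
- exact: bruhat_trans IH2.
Qed.

Lemma down_le_down x y s : S s -> x <=B y -> down s x <=B down s y.
Proof.
move=> Ss; elim=> [v w vw|v|u v w _ IH1 _ IH2].
- case: (step_mulgen Ss vw) => [->|svw].
    rewrite /down descent_gen_mul // genK //.
    by case: (N v s); apply: bruhat_refl.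
  have [dv dsv] := down_le v Ss.
  rewrite {2}/down; case: ifP => _;
    [apply: bruhat_trans dsv _|apply: bruhat_trans dv _] => //.
  exact: rt_step.
- exact: bruhat_refl.
- exact: bruhat_trans IH2.
Qed.

(** Here [down s x] is [x] itself, so this is [down_le_down] followed by
    [down s w <= s * w]. *)
Lemma bruhat_mulgen x w s : S s -> ~~ N x s -> x <=B w -> x <=B s * w.
Proof.
move=> Ss xs /(down_le_down Ss); rewrite {1}/down (negbTE xs) => xw.
by apply: bruhat_trans xw _; have [] := down_le w Ss.
Qed.

Lemma bruhat_mulgenr p w r : S r -> p <=B p * r -> p <=B w -> p <=B w * r.
Proof.
move=> Sr ppr pw.
have rp : ~~ N p^-1 r.
  apply/negP => /(bruhat_descent Sr) /bruhatV.
  rewrite invgM invgK (gen_invg Sr) => prp.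
  have /(congr1 (fun v => p^-1 * v)) := bruhat_anti ppr prp.
  rewrite mulVg mulKg => r1; have := cocycle_gen Sr.
  by rewrite -r1 => /(congr1 (@^~ 1)); rewrite cocycle1 eqxx.
have := bruhat_mulgen Sr rp (bruhatV pw) => /bruhatV.
by rewrite invgM !invgK (gen_invg Sr).
Qed.

(** The right-handed form of [down_le_down] at a right descent of [w]. *)
Lemma descentr_le a w r : S r -> a <=B w -> ~ w <=B w * r ->
  (a <=B w * r \/ a * r <=B w * r) /\ (len (w * r) < len w)%N.
Proof.
move=> Sr aw wr.
have Ew : r * w^-1 = (w * r)^-1 by rewrite invgM (gen_invg Sr).
have rw : N w^-1 r.
  apply/negP => /negP /(bruhat_ascent Sr); rewrite Ew.
  by move=> /bruhatV; rewrite !invgK.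
split; last by have := descent_length Sr rw; rewrite Ew !lengthV.
have := down_le_down Sr (bruhatV aw); rewrite {2}/down rw Ew => /bruhatV.
rewrite invgK /down; case: ifP => _; rewrite ?invgM ?invgK ?(gen_invg Sr) //.
  by right.
by left.
Qed.

Lemma bruhat1_le x : 1 <=B x.
Proof.
have [n xn] := ubnP (len x); elim: n x xn => // n IH x xn.
have [->|/descent_exists [s Ss xs]] := pselect (x = 1).
  exact: bruhat_refl.
apply: bruhat_trans (bruhat_descent Ss xs); apply: IH.
exact: leq_trans (descent_length Ss xs) xn.
Qed.

(** * Parabolic cosets *)

Section Parabolic.
Variable J : set W.
Hypothesis JS : J `<=` S.

Local Notation WJ := (generated_subgroup J).

Lemma parabolic1 : WJ 1.
Proof. by move=> H [[H1 _] _]; rewrite inE in H1. Qed.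

Lemma parabolicF u v : WJ u -> WJ v -> WJ (u / v).
Proof.
move=> uJ vJ H HJ; have [[_ HF] _] := HJ.
by have := HF u v; rewrite !inE; apply; [apply: uJ|apply: vJ].
Qed.

Lemma parabolicV u : WJ u -> WJ u^-1.
Proof. by move=> uJ; rewrite -[u^-1]mul1g; apply: parabolicF parabolic1 uJ. Qed.

Lemma parabolicM u v : WJ u -> WJ v -> WJ (u * v).
Proof. by move=> uJ /parabolicV vJ; rewrite -[v]invgK; apply: parabolicF. Qed.

Lemma parabolic_gen r : J r -> WJ r.
Proof. exact: sub_gen_smallest. Qed.

Definition coset_eq u w := WJ (u^-1 * w).

Lemma coset_refl u : coset_eq u u.
Proof. by rewrite /coset_eq mulVg; apply: parabolic1. Qed.

Lemma coset_sym u w : coset_eq u w -> coset_eq w u.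
Proof. by move=> /parabolicV; rewrite invgM invgK. Qed.

Lemma coset_trans v u w : coset_eq u v -> coset_eq v w -> coset_eq u w.
Proof. by move=> uv /(parabolicM uv); rewrite -mulgA mulVKg. Qed.

Lemma coset_mul2l s u w : coset_eq u w -> coset_eq (s * u) (s * w).
Proof. by rewrite /coset_eq invgM -mulgA mulKg. Qed.

Lemma coset_mulgen w r : J r -> coset_eq w (w * r).
Proof. by move=> Jr; rewrite /coset_eq mulKg; apply: parabolic_gen. Qed.

(** A property stable under right multiplication by [J] is invariant under
    it, as the elements of [J] are involutions; the elements that leave it
    invariant form a subgroup. *)
Lemma coset_ind (P : W -> Prop) :
  (forall w r, J r -> P w -> P (w * r)) ->
  forall u w, coset_eq u w -> P u -> P w.
Proof.
move=> PJ u w uw Pu.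
have subJ : WJ `<=` [set v | forall w, P w <-> P (w * v)].
  apply: smallest_sub => [|r Jr v]; last first.
    split; first exact: PJ.
    by move=> Pvr; rewrite -(genKr v (JS Jr)); apply: PJ.
  split=> [|a b]; rewrite !inE /=; first by move=> v; rewrite mulg1.
  by move=> Pa Pb v; rewrite mulgA (Pb (v * a / b)) mulgVK -Pa.
by have := subJ _ uw u; rewrite mulVKg => <-.
Qed.

(** Passing from [v] to [v * r] changes whether [s] is a left descent only if
    [s * v = v * r], and then [s] maps the coset to itself. *)
Lemma coset_descent s u w : S s -> ~ coset_eq u (s * u) -> coset_eq u w ->
  N w s = N u s.
Proof.
move=> Ss su uw; suff : coset_eq u w /\ N w s = N u s by case.
apply: (coset_ind (P := fun v => coset_eq u v /\ N v s = N u s) _ uw).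
  move=> v r Jr [uv <-]; have uvr := coset_trans uv (coset_mulgen v Jr).
  split=> //; rewrite cocycleM (cocycle_gen (JS Jr)) /=.
  case: eqP => [svr|_]; last by rewrite addbF.
  case: su; apply: coset_trans uvr _.
  by rewrite -svr -conjgC; apply: coset_mul2l; apply: coset_sym.
by split=> //; apply: coset_refl.
Qed.

(** Let [s] be a left descent of [y]; then [w <= y] is equivalent to
    [down s w <= s y]. If [s] preserves the coset, and [m] is the greatest
    element of the coset below [s y], then [up s m] is the greatest one below
    [y]. Otherwise either [s] is a descent of every element of the coset, and
    the maximum is [s] times that of [s u W_J] below [s y]; or it is a descent
    of none, and then the elements of the coset below [y] are those below
    [s y]. *)
Lemma max_below y u : (exists2 w, coset_eq u w & w <=B y) ->
  exists m, [/\ coset_eq u m, m <=B y &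
    forall w, coset_eq u w -> w <=B y -> w <=B m].
Proof.
have [n yn] := ubnP (len y); elim: n y u yn => // n IH y u yn [w0 uw0 w0y].
have [y1|/descent_exists [s Ss ys]] := pselect (y = 1).
  have below1 w : w <=B 1 -> w = 1.
    move=> /bruhat_length [//|]; suff -> : len 1 = 0%N by [].
    by apply/eqP; rewrite -leqn0; apply/length_min/expressible1.
  move: w0y; rewrite y1 => /below1 w01; exists 1; rewrite -{1}w01.
  by split=> //; apply: bruhat_refl.
have ltsy : (len (s * y) < n)%N := leq_trans (descent_length Ss ys) yn.
have syy := bruhat_descent Ss ys.
have dwn w : w <=B y -> down s w <=B s * y.
  by move=> /(down_le_down Ss); rewrite {2}/down ys.
have uwn w : w <=B s * y -> up s w <=B y.
  move=> /(up_le_up Ss); rewrite {2}/up descent_gen_mul // ys /=.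
  by rewrite genK.
have [usu|usu] := pselect (coset_eq u (s * u)).
  have stable w : coset_eq u w -> coset_eq u (s * w).
    by move=> /(coset_mul2l s); apply: coset_trans.
  have [|m [um my mmax]] := IH _ u ltsy.
    exists (down s w0); last exact: dwn.
    by rewrite /down; case: ifP => _ //; apply: stable.
  exists (up s m); split; [|exact: uwn|].
    by rewrite /up; case: ifP => _ //; apply: stable.
  move=> w uw wy; have [lem lesm] := le_up m Ss.
  have := dwn _ wy; rewrite /down; case: ifPn => ws wsy.
    have /(up_le_up Ss) := mmax _ (stable _ uw) wsy.
    by rewrite {1}/up descent_gen_mul // ws /= genK.
  exact: bruhat_trans (mmax _ uw wsy) lem.
have dirE w := @coset_descent s u w Ss usu.
case: (boolP (N u s)) => us.
  have [|m [um my mmax]] := IH _ (s * u) ltsy.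
    exists (s * w0); first exact: coset_mul2l.
    by have := dwn _ w0y; rewrite /down dirE // us.
  have usm : coset_eq u (s * m) by have := coset_mul2l s um; rewrite genK.
  have ms : ~~ N m s by have := dirE _ usm; rewrite descent_gen_mul // us.
  exists (s * m); split=> //.
    by have := uwn _ my; rewrite /up (negbTE ms).
  move=> w uw wy; have := dwn _ wy; rewrite /down dirE // us.
  move=> /(mmax _ (coset_mul2l s uw)) /(up_le_up Ss).
  by rewrite /up descent_gen_mul // dirE // us (negbTE ms) genK.
have [|m [um my mmax]] := IH _ u ltsy.
  by exists w0 => //; have := dwn _ w0y; rewrite /down dirE // (negbTE us).
exists m; split=> //; first exact: bruhat_trans syy.
move=> w uw /dwn; rewrite /down dirE // (negbTE us); exact: mmax.
Qed.

(** These are the elements without right descents in [J], hence the minimal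
    coset representatives. *)
Definition reduced p := forall r, J r -> p <=B p * r.

(** The set of elements above [p] is stable under each right ascent of [p],
    hence under [J]. *)
Lemma reduced_le p w : reduced p -> coset_eq p w -> p <=B w.
Proof.
move=> p_red pw; apply: (coset_ind _ pw); last exact: bruhat_refl.
move=> v r Jr; exact/bruhat_mulgenr/p_red/Jr/JS.
Qed.

(** Projection to minimal coset representatives is monotone. Only [w] is
    brought to a reduced element here: each right descent of [w] in [J] is
    removed, and [a] is moved within its coset to stay below. *)
Lemma reduce_le a w : a <=B w -> exists a' w',
  [/\ coset_eq a a', coset_eq w w', reduced w' & a' <=B w'].
Proof.
have [n wn] := ubnP (len w); elim: n a w wn => // n IH a w wn aw.
have [wred|/existsNP [r /not_implyP [Jr wr]]] := pselect (reduced w).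
  by exists a, w; split=> //; apply: coset_refl.
have [le_r lt_r] := descentr_le (JS Jr) aw wr.
have wrn : (len (w * r) < n)%N := leq_trans lt_r wn.
have wwr := coset_mulgen w Jr; have aar := coset_mulgen a Jr.
case: le_r => /(IH _ _ wrn) [a' [w' [aa' ww' wred aw']]]; exists a', w'.
  by split=> //; apply: coset_trans ww'.
by split=> //; [apply: coset_trans aa'|apply: coset_trans ww'].
Qed.

(** By monotonicity of the projection, the minimal representative of [w W_J]
    lies between those of [a W_J] and of [b W_J], which are the same. *)
Lemma coset_convex a b w : coset_eq a b -> a <=B w -> w <=B b -> coset_eq a w.
Proof.
move=> ab aw wb.
have [a' [w' [aa' ww' wred aw']]] := reduce_le aw.
have [w2 [b' [ww2 bb' bred w2b']]] := reduce_le wb.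
have w'w2 : w' <=B w2.
  by apply: reduced_le => //; apply: coset_trans ww2; apply: coset_sym.
have b'a' : b' <=B a'.
  apply: reduced_le => //; apply: coset_trans (coset_sym bb') _.
  exact: coset_trans (coset_sym ab) aa'.
(* [w'] and [b'] are least in their cosets: [a' <= w' <= w2 <= b' <= a']. *)
have E : a' = w'.
  apply: bruhat_anti => //; apply: bruhat_trans w'w2 _.
  exact: bruhat_trans w2b' b'a'.
rewrite E in aa'; exact: coset_trans aa' (coset_sym ww').
Qed.

(** The coset is reached from [W_J], whose least element above [x] is [x]
    itself, by left multiplications that increase all of its elements. Under
    such a multiplication by [s] the bound [x] becomes [down s x]: if [s] is a
    descent of [w], then [x <= w] is equivalent to [down s x <= s w]. *)
Lemma min_above x u : (exists2 w, coset_eq u w & x <=B w) ->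
  exists m, [/\ coset_eq u m, x <=B m &
    forall w, coset_eq u w -> x <=B w -> m <=B w].
Proof.
have [n un] := ubnP (len u); elim: n x u un => // n IH x u un [w0 uw0 xw0].
have [[v uv vu]|umin] := pselect (exists2 v, coset_eq u v & (len v < len u)%N).
  have vn : (len v < n)%N := leq_trans vu un.
  have [|m [vm xm mmin]] := IH x v vn.
    by exists w0 => //; apply: coset_trans uw0; apply: coset_sym.
  exists m; split=> //; first exact: coset_trans vm.
  by move=> w uw; apply: mmin; apply: coset_trans uw; apply: coset_sym.
have [u1|/descent_exists [s Ss us]] := pselect (u = 1).
  (* The coset is [W_J], which contains [x] since [1 <= x <= w0]. *)
  exists x; split=> //; last exact: bruhat_refl.
  by rewrite u1 in uw0 *; apply: coset_convex uw0 (bruhat1_le x) xw0.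
have lesu := descent_length Ss us.
(* [u] has least length in its coset, so the shorter [s * u] is outside. *)
have usu : ~ coset_eq u (s * u) by move=> usu; apply: umin; exists (s * u).
have down_w w : coset_eq u w -> x <=B w -> down s x <=B s * w.
  move=> uw /(down_le_down Ss).
  by rewrite {2}/down (coset_descent Ss usu uw) us.
have [|m [um xm mmin]] := IH (down s x) (s * u) (leq_trans lesu un).
  by exists (s * w0); [apply: coset_mul2l|apply: down_w].
have usm : coset_eq u (s * m) by have := coset_mul2l s um; rewrite genK.
have ms : ~~ N m s.
  by have := coset_descent Ss usu usm; rewrite descent_gen_mul // us => ->.
have up_m : up s m = s * m by rewrite /up (negbTE ms).
exists (s * m); split=> //.
  rewrite -up_m; apply: bruhat_trans (up_le_up Ss xm).
  rewrite /down; case: ifPn => xs; last by have [] := le_up x Ss.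
  by rewrite /up descent_gen_mul // xs genK //; apply: bruhat_refl.
move=> w uw /(down_w w uw) /(mmin _ (coset_mul2l s uw)) /(up_le_up Ss).
rewrite up_m /up descent_gen_mul // genK //.
by rewrite (coset_descent Ss usu uw) us.
Qed.

Lemma coset_interval x y u :
  (exists w, [/\ x <=B w, w <=B y & coset_eq u w]) ->
  exists a b, a <=B b /\
    forall w, (x <=B w /\ w <=B y) /\ coset_eq u w <-> a <=B w /\ w <=B b.
Proof.
move=> [z [xz zy uz]].
have [|a [ua xa amin]] := @min_above x u; first by exists z.
have [|b [ub by_ bmax]] := @max_below y u; first by exists z.
exists a, b; split; first by apply: bruhat_trans (amin z uz xz) (bmax z uz zy).
have ab := coset_trans (coset_sym ua) ub.
move=> w; split=> [[[xw wy] uw]|[aw wb]].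
  by split; [apply: amin|apply: bmax].
split; first by split; [apply: bruhat_trans aw|apply: bruhat_trans by_].
exact: coset_trans (coset_convex ab aw wb).
Qed.

End Parabolic.
End Coxeter.

Theorem theorem3p1 (W : groupType) (S : set W) (hWS : coxeter_system S)
    (x y : W) (hxy : bruhat S x y)
    (J : set W) (hJ : J `<=` S)
    (C : set W) (hC : parabolic_coset J C)
    (hne : bruhat_interval S x y `&` C !=set0) :
  exists a b : W,
    bruhat S a b /\ bruhat_interval S x y `&` C = bruhat_interval S a b.
Proof.
have [N [cocycle_gen cocycleM]] := inversion_cocycle hWS.
have [m [[mss _ _] genS mrel _]] := hWS.
have invS s : S s -> s * s = 1.
  by move=> Ss; have := mrel s s Ss Ss 1%N (mss s Ss); rewrite expg1.
have interval := coset_interval invS genS cocycle_gen cocycleM hJ.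
have leV v w : bruhat S v w <-> bruhat S v^-1 w^-1.
  split; first exact: (bruhatV invS genS cocycle_gen cocycleM).
  move=> /(bruhatV invS genS cocycle_gen cocycleM); by rewrite !invgK.
have [u [CE|CE]] := hC.
  have CP w : C w <-> coset_eq J u w.
    rewrite CE; split=> [[v vJ <-]|uw]; first by rewrite /coset_eq mulKg.
    by exists (u^-1 * w); rewrite ?mulVKg.
  have [|a [b [ab abE]]] := interval x y u.
    by have [z [[xz zy] /CP uz]] := hne; exists z.
  exists a, b; split=> //; apply/seteqP.
  by split=> w; [move=> [xwy /CP uw]; apply/abE|move=> /abE [xwy /CP]].
have CP w : C w <-> coset_eq J u^-1 w^-1.
  have CP' : C w <-> generated_subgroup J (w / u).
    rewrite CE; split=> [[v vJ <-]|uw]; first by rewrite mulgK.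
    by exists (w / u); rewrite ?mulgVK.
  apply: (iff_trans CP'); rewrite /coset_eq invgK.
  by split=> /parabolicV; rewrite invgM ?invgK.
have [|a [b [ab abE]]] := interval x^-1 y^-1 u^-1.
  have [z [[/leV xz /leV zy] /CP uz]] := hne.
  by exists z^-1.
exists a^-1, b^-1; split; first by apply/leV; rewrite !invgK.
apply/seteqP; split=> w.
  move=> [[/leV xw /leV wy] /CP uw].
  have [aw wb] := (abE w^-1).1 (conj (conj xw wy) uw).
  by split; apply/leV; rewrite invgK.
move=> [/leV + /leV]; rewrite !invgK => aw wb.
have [[xw wy] uw] := (abE w^-1).2 (conj aw wb).
by split; [split; apply/leV|apply/CP].
Qed.
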